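(* Let $W$ be a positive random variable satisfying $$\lim_{x \to 0^+} \frac{\log \log \left(1/\mathbb{P}(W \leq x)\right)}{\log \log (1/x)} = \gamma$$ for some real $\gamma > 1$. Let $Y$ be a fixed point of the smoothing transform associated to $W$, i.e. a positive random variable such that $$Y \stackrel{d}{=} W_0 Y_0 + W_1 Y_1,$$ where $W_0, W_1, Y_0, Y_1$ are independent, $W_0$ and $W_1$ have the same distribution as $W$, and $Y_0$ and $Y_1$ have the same distribution as $Y$. Then $$\lim_{t \to \infty} \frac{\log \log \left(1/\mathbb{E}\, e^{-tY}\right)}{\log \log t} = \gamma.$$
   Context: A random variable $X$ is called positive if $\mathbb{P}(X>0)=1$. The symbol $\stackrel{d}{=}$ denotes equality in distribution. (Limits of Mandelbrot cascades on the binary tree generated by $W$, possibly renormalized, are examples of such fixed points $Y$.) *)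

(* Defs.v *)
From HB Require Import structures.
From mathcomp Require Export all_boot all_order all_algebra.
From mathcomp Require Export all_classical all_reals all_analysis.
Export Order.TTheory GRing.Theory Num.Theory.
Export numFieldNormedType.Exports.

Set Implicit Arguments.
Unset Strict Implicit.
Unset Printing Implicit Defensive.

Local Open Scope classical_set_scope.
Local Open Scope ring_scope.

Definition positive_rv d (T : measurableType d) (R : realType)
    (P : probability T R) (X : {RV P >-> R}) : Prop :=
  P [set w | 0 < X w] = 1%E.

(* The two variables may live on different probability spaces. *)
Definition eq_in_distribution (R : realType)
    d (T : measurableType d) (P : probability T R) (X : T -> R)
    d' (T' : measurableType d') (P' : probability T' R) (X' : T' -> R) : Prop :=
  forall A : set R, measurable A -> pushforward P X A = pushforward P' X' A.

(* Mutual (not merely pairwise) independence. *)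
Definition mutually_independent d (T : measurableType d) (R : realType)
    (P : probability T R) (I : finType) (X : I -> {RV P >-> R}) : Prop :=
  forall (J : {set I}) (B : I -> set R), (forall i, measurable (B i)) ->
    P (\bigcap_(i in [set` J]) (X i @^-1` B i)) =
    (\prod_(i in J) P (X i @^-1` B i))%E.

(* Only the laws of [W] and [Y] matter: the independent copies are taken on
   some auxiliary probability space. *)
Definition smoothing_fixed_point (R : realType)
    d (T : measurableType d) (P : probability T R) (W : {RV P >-> R})
    d' (T' : measurableType d') (P' : probability T' R)
    (Y : {RV P' >-> R}) : Prop :=
  positive_rv Y /\
  exists (d0 : measure_display) (T0 : measurableType d0)
    (P0 : probability T0 R) (W0 W1 Y0 Y1 : {RV P0 >-> R}),
    [/\ mutually_independent (tnth [tuple W0; W1; Y0; Y1]),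
        eq_in_distribution P0 W0 P W /\ eq_in_distribution P0 W1 P W,
        eq_in_distribution P0 Y0 P' Y /\ eq_in_distribution P0 Y1 P' Y &
        eq_in_distribution P' Y P0 (W0 \* Y0 \+ W1 \* Y1)].

(* Main.v *)
(* Let p be the distribution function of W and G that of Y. If
   W0 Y0 + W1 Y1 <= x y with all variables positive, then for both i either
   Wi <= x or Yi <= y, whence G(xy) <= (p(x) + G(y))^2; conversely, Wi <= x and
   Yi <= y for both i give (p(x) G(y))^2 <= G(2xy). The second inequality with
   y fixed bounds G(2e^-u y) below by a constant times p(e^-u)^2. For the upper
   bound, put th^b = 1/2: since 4 G(e^-u) <= (2 p(e^-(1-th)u) + 2 G(e^-th u))^2,
   a bound 4 G(e^-v) <= exp(-c v^b) at v = th u propagates to v = u as long as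
   p(e^-v) <= exp(-v^b). Finally exp(-ty) G(y) <= E exp(-tY) <= G(y) + exp(-ty)
   transfers the bounds to the Laplace transform. *)
Require Import Defs.
From mathcomp Require Import measurable_realfun.
From mathcomp Require Import ring lra.

Set Implicit Arguments.
Unset Strict Implicit.
Unset Printing Implicit Defensive.

Local Open Scope classical_set_scope.
Local Open Scope ring_scope.

(** * Elementary bounds for iterated logarithms and powers *)

(** Exponentiating twice gives the bounds. The condition [0 <= s] forces the double logarithm to be
    positive, which excludes the default value 0 of [ln] and yields [1 < ln (1 / q)], hence
    [0 < q]. *)
Lemma lnln_ratio_bounds (R : realType) (q a s r : R) :
  0 <= s -> 1 < a -> s < ln (ln (1 / q)) / ln a < r ->
  expR (- a `^ r) < q < expR (- a `^ s).
Proof.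
move=> s0 a1; have lna0 : 0 < ln a by exact: ln_gt0.
rewrite ltr_pdivlMr// ltr_pdivrMr// => /andP[sL Lr].
have L0 : 0 < ln (ln (1 / q)) by rewrite (le_lt_trans _ sL)// mulr_ge0// ltW.
have lnq1 : 1 < ln (1 / q).
  by rewrite ltNge; apply/negP => /ln_le0; rewrite leNgt L0.
have q1 : 1 < 1 / q.
  by rewrite ltNge; apply/negP => /ln_le0; rewrite leNgt (lt_trans _ lnq1).
have q0 : 0 < q by rewrite -invr_gt0 -div1r (lt_trans _ q1).
have lnqE : ln (1 / q) = - ln q by rewrite div1r lnV.
have expL : expR (ln (ln (1 / q))) = - ln q.
  by rewrite lnK ?lnqE// posrE -lnqE (lt_trans _ lnq1).
have a0 : 0 < a by exact: lt_trans a1.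
have aE z : a `^ z = expR (z * ln a).
  by rewrite [z * _]mulrC expRM lnK.
rewrite -[q in _ < q < _](lnK q0) !ltr_expR ltrNl -expL aE ltr_expR Lr.
by rewrite ltrNr -expL aE ltr_expR.
Qed.

Lemma near_pinfty_powR_ge (R : realType) (C e : R) : 0 < e ->
  \forall u \near +oo, C <= u `^ e.
Proof.
move=> e0; near=> u.
rewrite (@le_trans _ _ (Num.max 0 C))//; first by rewrite le_max lexx orbT.
have m0 : 0 <= Num.max 0 C by rewrite le_max lexx.
rewrite -[leLHS]powRr1// -(mulVf (lt0r_neq0 e0)) powRrM.
have Au : Num.max 0 C `^ e^-1 <= u.
  by near: u; exact: nbhs_pinfty_ge (num_real _).
by rewrite ge0_ler_powR ?nnegrE ?powR_ge0 ?(ltW e0)// (le_trans _ Au) ?powR_ge0.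
Unshelve. all: by end_near. Qed.

Lemma near_pinfty_forall_ge (R : realType) (Q : R -> Prop) :
  (\forall u \near +oo, Q u) ->
  \forall A \near +oo, forall u, A <= u -> Q u.
Proof.
by case=> M [Mr MQ]; exists M; split => // A MA u Au; apply/MQ/(lt_le_trans MA).
Qed.

(** * Bootstrap for the distribution function near 0 *)

Lemma smoothing_tail_decay (R : realType) (p G : R -> R) (b : R) :
  0 < b -> {homo G : x y / x <= y} -> (forall x, 0 <= G x) ->
  (forall x, 0 <= p x) ->
  (forall x y, 0 < x -> 0 < y -> G (x * y) <= (p x + G y) ^+ 2) ->
  (\forall a \near +oo, p (expR (- a)) <= expR (- a `^ b)) ->
  (\forall u \near +oo, 4 * G (expR (- u)) <= expR (- 1)) ->
  exists2 c, 0 < c &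
    \forall u \near +oo, 4 * G (expR (- u)) <= expR (- (c * u `^ b)).
Proof.
move=> b0 Gmono G0 p0 GG pb Gsmall.
pose th : R := 2^-1 `^ b^-1.
have th0 : 0 < th by rewrite powR_gt0// invr_gt0.
have thb : th `^ b = 2^-1.
  by rewrite -powRrM mulVf ?gt_eqF// powRr1// invr_ge0.
have th1 : th < 1.
  rewrite ltNge; apply/negP => th1.
  have : 1 `^ b <= th `^ b by rewrite ge0_ler_powR ?nnegrE// ltW.
  rewrite thb powR1; lra.
pose k := (1 - th) `^ b.
have k0 : 0 < k by rewrite powR_gt0// subr_gt0.
have [u1 [u1_ge1 Gu1 pu1 ku1]] : exists u1, [/\ 1 <= u1,
    4 * G (expR (- u1)) <= expR (- 1),
    forall u, u1 <= u -> p (expR (- ((1 - th) * u))) <= expR (- ((1 - th) * u) `^ b)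
  & forall u, u1 <= u -> 2 * ln 4 / k <= u `^ b].
  have [A A1 PA] := pinfty_ex_ge (num_real 1) (near_pinfty_forall_ge pb).
  have kb := near_pinfty_forall_ge (near_pinfty_powR_ge (2 * ln 4 / k) b0).
  near (pinfty_nbhs R) => u1; exists u1; split.
  - by near: u1; exact: nbhs_pinfty_ge (num_real _).
  - by near: u1.
  - have Au1 : A / (1 - th) <= u1 by near: u1; exact: nbhs_pinfty_ge (num_real _).
    move=> u u1u; apply: PA; rewrite mulrC -ler_pdivrMr ?subr_gt0//.
    exact: le_trans u1u.
  - by near: u1.
have u10 : 0 < u1 by exact: lt_le_trans u1_ge1.
pose c := Num.min k ((u1 / th) `^ b)^-1.
have c0 : 0 < c by rewrite lt_min k0/= invr_gt0 powR_gt0// divr_gt0.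
exists c => //.
have base u : u1 <= u -> u <= u1 / th ->
    4 * G (expR (- u)) <= expR (- (c * u `^ b)).
  move=> u1u uth; apply: (@le_trans _ _ (4 * G (expR (- u1)))).
    by rewrite ler_wpM2l// Gmono// ler_expR lerN2.
  rewrite (le_trans Gu1)// ler_expR lerN2.
  have u0 : 0 <= u by rewrite (le_trans _ u1u)// ltW.
  have ub : u `^ b <= (u1 / th) `^ b.
    by rewrite ge0_ler_powR ?nnegrE// ?(ltW b0)// divr_ge0 ?ltW.
  apply: (@le_trans _ _ (((u1 / th) `^ b)^-1 * (u1 / th) `^ b)).
    by rewrite ler_pM ?(ltW c0) ?powR_ge0// ge_min lexx orbT.
  by rewrite mulVf// gt_eqF// powR_gt0// divr_gt0.
have step n : forall u, u1 <= u -> u <= u1 * (th^-1) ^+ n ->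
    4 * G (expR (- u)) <= expR (- (c * u `^ b)).
  elim: n => [|n IH] u u1u un.
    apply: base => //; rewrite (le_trans un)// expr0 mulr1 ler_pdivlMr//.
    by rewrite ler_piMr// ltW.
  have [/base->//|uth] := leP u (u1 / th).
  have u0 : 0 < u by rewrite (lt_le_trans _ u1u).
  have thu : u1 <= th * u by rewrite mulrC -ler_pdivrMr// ltW.
  have /IH {}IH := thu.
  have /IH : th * u <= u1 * th^-1 ^+ n.
    by rewrite mulrC -ler_pdivlMr// -mulrA -exprSr.
  rewrite powRM ?(ltW th0) ?(ltW u0)// thb => IHu.
  have := GG _ _ (expR_gt0 (- ((1 - th) * u))) (expR_gt0 (- (th * u))).
  rewrite -expRD (_ : - ((1 - th) * u) + _ = - u) => [GGu|]; last by ring.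
  set E := expR (- (c * (2^-1 * u `^ b))) in IHu.
  have -> : expR (- (c * u `^ b)) = E ^+ 2.
    by rewrite /E expr2 -expRD; congr expR; field.
  (* With [4 * x <= E] for the [p] term and [4 * y <= E] from the induction hypothesis,
     [2 * (x + y) <= E]; squaring gives the claim at [u]. *)
  have pE : 4 * p (expR (- ((1 - th) * u))) <= E.
    apply: (@le_trans _ _ (4 * expR (- ((1 - th) * u) `^ b))).
      by rewrite ler_wpM2l// pu1.
    rewrite -[4 in leLHS]lnK ?posrE// -expRD ler_expR.
    rewrite powRM ?subr_ge0 ?(ltW th1) ?(ltW u0)// -/k.
    have := ku1 _ u1u; rewrite ler_pdivrMr// => ku.
    have ck : c <= k by rewrite ge_min lexx.
    have : c * u `^ b <= k * u `^ b by rewrite ler_wpM2r// powR_ge0.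
    lra.
  have := p0 (expR (- ((1 - th) * u))); have := G0 (expR (- (th * u))).
  have E0 : 0 < E by exact: expR_gt0.
  move: pE GGu IHu; set x := p _; set y := G (expR (- (th * u))) => pE GGu IHu y0 x0.
  have xy : 2 * (x + y) <= E by lra.
  apply: (@le_trans _ _ ((2 * (x + y)) ^+ 2)); first by rewrite exprMn; lra.
  by rewrite ler_pXn2r// nnegrE; lra.
near=> u.
have u1u : u1 <= u by near: u; exact: nbhs_pinfty_ge (num_real _).
have u0 : 0 < u by rewrite (lt_le_trans _ u1u).
(* Since [th ^+ n] tends to 0, some [n] satisfies [u <= u1 / th ^+ n]. *)
have /cvgrPdist_lt/(_ (u1 / u)) : th ^+ n @[n --> \oo] --> 0.
  by apply: cvg_expr; rewrite gtr0_norm.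
rewrite divr_gt0// => /(_ isT) [n _ /(_ n)]/=.
rewrite leqnn sub0r normrN gtr0_norm ?exprn_gt0// => /(_ isT) thn.
apply: (step n) => //; rewrite exprVn ler_pdivlMr ?exprn_gt0//.
by rewrite mulrC -ler_pdivlMr// ltW.
Unshelve. all: by end_near. Qed.

(** * Exponential substitutions and the analytic form of the theorem *)

Lemma near_right0_expRN (R : realType) (Q : R -> Prop) :
  (\forall x \near 0^'+, Q x) -> \forall a \near +oo, Q (expR (- a)).
Proof.
case=> d /= d0 dQ; near=> a; apply: dQ; rewrite ?expR_gt0//.
rewrite /= sub0r normrN gtr0_norm ?expR_gt0// -[ltRHS]lnK ?posrE// ltr_expR.
by rewrite ltrNl; near: a; exact: nbhs_pinfty_gt (num_real _).
Unshelve. all: by end_near. Qed.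

Lemma near_pinfty_expR (R : realType) (Q : R -> Prop) :
  (\forall u \near +oo, Q (expR u)) -> \forall t \near +oo, Q t.
Proof.
case=> M [Mr MQ]; near=> t.
have t0 : 0 < t by near: t; exact: nbhs_pinfty_gt (num_real _).
have Mt : expR M < t by near: t; exact: nbhs_pinfty_gt (num_real _).
by rewrite -[t]lnK ?posrE//; apply: MQ; rewrite -ltr_expR lnK ?posrE.
Unshelve. all: by end_near. Qed.

(** Raise [v / s <= expR (v / s)] to the power [s]. *)
Lemma powR_le_expR (R : realType) (s v : R) : 0 < s -> 0 <= v ->
  (s `^ s)^-1 * v `^ s <= expR v.
Proof.
move=> s0 v0.
have -> : expR v = (expR (v / s)) `^ s.
  by rewrite -expRM divfK// gt_eqF.
have vs : 0 <= v / s by rewrite divr_ge0// ltW.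
have -> : (s `^ s)^-1 * v `^ s = (v / s) `^ s.
  rewrite powRM// ?invr_ge0 ?(ltW s0)// mulrC; congr (_ * _).
  by rewrite -(powR_inv1 (ltW s0)) -powRrM mulN1r powRN.
rewrite ge0_ler_powR ?nnegrE ?expR_ge0 ?(ltW s0)//.
by rewrite (le_trans _ (expR_ge1Dx _))// lerDr.
Qed.

(** Here [p] and [G] stand for the distribution functions of [W] and [Y], and [phi] for the Laplace
    transform of [Y]. With t = e^u the denominator becomes [ln u], and it suffices to squeeze
    [- ln (phi t)] between the powers of [u] with exponents [gamma - 2 * e] and [gamma + 2 * e]. *)
Lemma smoothing_laplace_cvg (R : realType) (gamma : R) (p G phi : R -> R) :
  1 < gamma -> {homo G : x y / x <= y} -> (forall x, 0 <= G x) ->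
  (forall x, 0 <= p x) ->
  (forall x y, 0 < x -> 0 < y -> G (x * y) <= (p x + G y) ^+ 2) ->
  (forall x y, 0 < x -> 0 < y -> (p x * G y) ^+ 2 <= G (2 * (x * y))) ->
  (forall t y, 0 < t -> 0 < y -> phi t <= G y + expR (- (t * y))) ->
  (forall t y, 0 < t -> 0 < y -> expR (- (t * y)) * G y <= phi t) ->
  (\forall y \near 0^'+, 4 * G y <= expR (- 1)) ->
  (exists2 K, 0 < K & 0 < G K) ->
  ln (ln (1 / p x)) / ln (ln (1 / x)) @[x --> 0^'+] --> gamma ->
  ln (ln (1 / phi t)) / ln (ln t) @[t --> +oo] --> gamma.
Proof.
move=> g1 Gmono G0 p0 Gle Gge phile phige Gsmall [K K0 GK0] pgamma.
apply/cvgrPdist_lt => eps eps0; apply: near_pinfty_expR.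
(* One [e] is lost to the hypothesis on [p], a second to multiplicative constants; [2 * e] stays
   strictly below [eps]. The minimum with 1 keeps [gamma - 2 * e] positive. *)
pose e := Num.min eps 1 / 4.
have e0 : 0 < e by rewrite divr_gt0// lt_min eps0/=.
have e1 : 4 * e <= 1 by rewrite /e mulrC divfK// ge_min lexx orbT.
have eeps : 4 * e <= eps by rewrite /e mulrC divfK// ge_min lexx.
have pb : \forall a \near +oo,
    expR (- a `^ (gamma + e)) < p (expR (- a)) < expR (- a `^ (gamma - e)).
  move/cvgrPdist_lt : pgamma => /(_ _ e0)/near_right0_expRN pb.
  near=> a; apply: lnln_ratio_bounds; first lra.
    by near: a; exact: nbhs_pinfty_gt (num_real _).
  have : `|gamma - ln (ln (1 / p (expR (- a)))) / ln (ln (1 / expR (- a)))| < e.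
    by near: a.
  rewrite -ltr_distlC; congr (`| _ - _ / ln _| < _).
  by rewrite div1r -expRN opprK expRK.
have [c c0 Gc] : exists2 c, 0 < c & \forall u \near +oo,
    4 * G (expR (- u)) <= expR (- (c * u `^ (gamma - e))).
  have g0 : 0 < gamma - e by lra.
  apply: (smoothing_tail_decay g0 Gmono G0 p0 Gle) (near_right0_expRN Gsmall).
  by apply: filterS pb => a /andP[_ /ltW].
pose s := gamma - e.
have s0 : 0 < s by rewrite /s; lra.
pose c1 := Num.min c (s `^ s)^-1.
have c10 : 0 < c1 by rewrite lt_min c0/= invr_gt0 powR_gt0.
pose c2 := c1 * 2^-1 `^ s.
have c20 : 0 < c2 by rewrite mulr_gt0// powR_gt0// invr_gt0.
(* The term [2 * K] is the exponent t y of the factor e^(-ty), and the rest comes from the square of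
   [G K]. *)
pose C := 2 * K - 2 * ln (G K).
near=> u.
have u1 : 1 < u by near: u; exact: nbhs_pinfty_gt (num_real _).
have u0 : 0 < u by exact: lt_trans u1.
have lnu0 : 0 < ln u by exact: ln_gt0.
have uge z : 0 <= z -> 1 <= u `^ z.
  by move=> z0; rewrite -(powRr0 u) ler_powR// ltW.
set q := phi (expR u).
have qge : expR (- (2 * u `^ (gamma + e) + C)) <= q.
  (* y = 2 K / t *)
  have := phige (expR u) (2 * (expR (- u) * K)) (expR_gt0 _).
  rewrite !mulr_gt0 ?expR_gt0// => /(_ isT).
  apply: le_trans.
  have -> : expR u * (2 * (expR (- u) * K)) = 2 * K.
    by rewrite mulrCA (mulrA (expR u)) expRxMexpNx_1 mul1r.
  have := Gge (expR (- u)) K (expR_gt0 _) K0; move/(ler_wpM2l (expR_ge0 (- (2 * K)))).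
  apply: le_trans; rewrite -[G K]lnK ?posrE//.
  have -> : expR (- (2 * u `^ (gamma + e) + C)) =
      expR (- (2 * K)) * (expR (- u `^ (gamma + e)) * expR (ln (G K))) ^+ 2.
    by rewrite expr2 -!expRD /C; congr expR; ring.
  rewrite ler_wpM2l ?expR_ge0// ler_pXn2r ?nnegrE ?mulr_ge0 ?expR_ge0//.
  rewrite ler_wpM2r ?expR_ge0//.
  have /andP[/ltW//] : expR (- u `^ (gamma + e)) < p (expR (- u)) < expR (- u `^ (gamma - e)).
  by near: u.
have q0 : 0 < q by rewrite (lt_le_trans _ qge) ?expR_gt0.
have qle : q <= expR (- (c2 * u `^ s - ln 2)).
  have v0 : 0 <= u / 2 by rewrite divr_ge0// ltW.
  (* y = t^(-1/2) *)
  apply: le_trans (phile _ (expR (- (u / 2))) (expR_gt0 _) (expR_gt0 _)) _.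
  rewrite -expRD (_ : u + - (u / 2) = u / 2); last by field.
  have -> : c2 * u `^ s = c1 * (u / 2) `^ s.
    by rewrite /c2 powRM ?invr_ge0 ?(ltW u0)//; ring.
  have vs0 : 0 <= (u / 2) `^ s by exact: powR_ge0.
  have : expR (- (c * (u / 2) `^ s)) <= expR (- (c1 * (u / 2) `^ s)).
    by rewrite ler_expR lerN2 ler_wpM2r// ge_min lexx.
  (* Here t y = e^(u/2), which outgrows every power of [u]. *)
  have : expR (- expR (u / 2)) <= expR (- (c1 * (u / 2) `^ s)).
    rewrite ler_expR lerN2 (le_trans _ (powR_le_expR s0 v0))// ler_wpM2r//.
    by rewrite ge_min lexx orbT.
  have : 4 * G (expR (- (u / 2))) <= expR (- (c * (u / 2) `^ s)).
    by near: u; exact: near_pinfty_div2 Gc.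
  rewrite opprB addrC expRD lnK ?posrE//.
  have := expR_gt0 (- (c1 * (u / 2) `^ s)); have := G0 (expR (- (u / 2))).
  lra.
have lnqE : ln (1 / q) = - ln q by rewrite div1r lnV.
have Lle : - ln q <= u `^ (gamma + 2 * e).
  have : - ln q <= 2 * u `^ (gamma + e) + C.
    by rewrite lerNl -ler_expR lnK.
  have -> : gamma + 2 * e = (gamma + e) + e by ring.
  rewrite [u `^ (_ + _ + e)]powRD; last by rewrite (gt_eqF u0) implybT.
  have ue : 2 + `|C| <= u `^ e by near: u; exact: near_pinfty_powR_ge e0.
  have ug : 1 <= u `^ (gamma + e) by apply: uge; lra.
  move=> /le_trans; apply.
  have Ca : `|C| <= u `^ (gamma + e) * `|C| by rewrite ler_peMl.
  have := ler_wpM2l (le_trans ler01 ug) ue; rewrite mulrDr.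
  have := ler_norm C; lra.
have Lge : u `^ (gamma - 2 * e) <= - ln q.
  have : c2 * u `^ s - ln 2 <= - ln q.
    by rewrite lerNr -ler_expR lnK.
  have -> : s = gamma - 2 * e + e by rewrite /s; ring.
  rewrite [u `^ (_ + _ + e)]powRD; last by rewrite (gt_eqF u0) implybT.
  have ue : 2 / c2 <= u `^ e by near: u; exact: near_pinfty_powR_ge e0.
  rewrite ler_pdivrMr// in ue.
  have ug : 1 <= u `^ (gamma - 2 * e) by apply: uge; lra.
  have ln2 : ln 2 <= 1 :> R.
    by rewrite (_ : 2 = 1 + 1)// le_ln1Dx.
  have := ler_wpM2l (le_trans ler01 ug) ue; lra.
have L0 : 0 < - ln q by rewrite (lt_le_trans _ Lge)// powR_gt0.
rewrite expRK lnqE ltr_distlC.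
have lnL1 : (gamma - 2 * e) * ln u <= ln (- ln q).
  by rewrite -ln_powR ler_ln ?posrE// powR_gt0.
have lnL2 : ln (- ln q) <= (gamma + 2 * e) * ln u.
  by rewrite -ln_powR ler_ln ?posrE// powR_gt0.
rewrite -ler_pdivlMr// in lnL1; rewrite -ler_pdivrMr// in lnL2.
apply/andP; split; lra.
Unshelve. all: by end_near. Qed.

(** * Measurability, independence and distribution functions *)

Lemma measurable_le_set (R : realType) (x : R) : measurable [set r : R | r <= x].
Proof. by rewrite -set_itvNyc; exact: measurable_itv. Qed.

Lemma measurable_rv_le d (T : measurableType d) (R : realType)
    (P : probability T R) (X : {RV P >-> R}) (x : R) :
  measurable [set w | X w <= x].
Proof. exact: measurable_funPTI X _ (measurable_le_set x). Qed.

Lemma fine_probability_subU d (T : measurableType d) (R : realType)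
    (P : probability T R) (A B C : set T) :
  measurable A -> measurable B -> measurable C -> A `<=` B `|` C ->
  fine (P A) <= fine (P B) + fine (P C).
Proof.
move=> mA mB mC ABC; rewrite -fineD ?fin_num_measure// fine_le//.
- exact: fin_num_measure.
- by rewrite fin_numD !fin_num_measure.
apply: (@le_trans _ _ (P (B `|` C))); last exact: measureU2.
by apply: le_measure => //; rewrite inE//; exact: measurableU.
Qed.

Lemma mutually_independent_pair d (T : measurableType d) (R : realType)
    (P : probability T R) (I : finType) (X : I -> {RV P >-> R}) (i j : I)
    (A B : set R) :
  mutually_independent X -> i != j -> measurable A -> measurable B ->
  P (X i @^-1` A `&` X j @^-1` B) = (P (X i @^-1` A) * P (X j @^-1` B))%E.
Proof.
move=> indep ij mA mB.
have ji : (j == i) = false by rewrite eq_sym; exact: negbTE.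
have := indep [set i; j]%SET (fun k => if k == i then A else B).
rewrite big_setU1 ?inE//= big_set1 eqxx ji => <-; last by move=> k; case: ifP.
congr (P _); apply/seteqP; split => [w [Aw Bw] k /= |w H].
  by rewrite !inE => /orP[] /eqP ->; rewrite ?eqxx ?ji.
split; first by have := H i; rewrite /= !inE !eqxx; exact.
by have := H j; rewrite /= !inE !eqxx orbT ji; exact.
Qed.

Lemma mutually_independent_all d (T : measurableType d) (R : realType)
    (P : probability T R) (I : finType) (X : I -> {RV P >-> R}) (B : I -> set R) :
  mutually_independent X -> (forall i, measurable (B i)) ->
  P (\bigcap_i (X i @^-1` B i)) = (\prod_i P (X i @^-1` B i))%E.
Proof.
move=> indep mB; have := indep [set: I]%SET B mB.
under eq_bigl do rewrite inE.
by move=> <-; congr (P _); apply/seteqP; split => w H i ?; apply: H; rewrite /= ?inE.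
Qed.

Lemma positive_rv_le0 d (T : measurableType d) (R : realType)
    (P : probability T R) (X : {RV P >-> R}) :
  positive_rv X -> P [set w | X w <= 0] = 0%E.
Proof.
move=> X0; have -> : [set w | X w <= 0] = ~` [set w | 0 < X w].
  by apply/seteqP; split => w /=; rewrite leNgt => /negP.
rewrite probability_setC ?X0 ?subee//.
have -> : [set w | 0 < X w] = ~` [set w | X w <= 0].
  by apply/seteqP; split => w /=; rewrite ltNge => /negP.
exact/measurableC/measurable_rv_le.
Qed.

(** The distribution function is right-continuous and vanishes at 0 by positivity. This starts the
    bootstrap. *)
Lemma near_right0_cdf d (T : measurableType d) (R : realType)
    (P : probability T R) (X : {RV P >-> R}) (e : R) :
  positive_rv X -> 0 < e ->
  \forall y \near 0^'+, fine (P [set w | X w <= y]) < e.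
Proof.
move=> X0 e0.
have cdfE r : cdf X r = P [set w | X w <= r].
  by rewrite /cdf /distribution /pushforward set_itvNyc.
have := @cdf_right_continuous _ _ _ P X 0.
rewrite cdfE positive_rv_le0// => /fine_cvg/cvgrPdist_lt/(_ _ e0).
apply: filterS => y /=.
by rewrite sub0r normrN cdfE ger0_norm// fine_ge0.
Qed.

(** The distribution function tends to 1 at infinity. This supplies the fixed point [K] of the lower
    bound. *)
Lemma exists_cdf_gt0 d (T : measurableType d) (R : realType)
    (P : probability T R) (X : {RV P >-> R}) :
  exists2 y, 0 < y & 0 < fine (P [set w | X w <= y]).
Proof.
have cdfE r : cdf X r = P [set w | X w <= r].
  by rewrite /cdf /distribution /pushforward set_itvNyc.
have /fine_cvg/cvgrPdist_lt/(_ _ ltr01)/pinfty_ex_gt0[y y0] := cvg_cdfy1 X.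
by rewrite /= cdfE ltr_distlC => /andP[]; rewrite subrr => Xy _; exists y.
Qed.

(** * Laplace transform against distribution function *)

(** The integrand is at most 1 where [X] is at most [y] and at most e^(-ty) elsewhere. The bound by
    1 uses [X > 0], so the comparison is only almost everywhere. *)
Lemma laplace_le d (T : measurableType d) (R : realType)
    (P : probability T R) (X : {RV P >-> R}) (t y : R) :
  positive_rv X -> 0 < t ->
  ('E_P[fun w => expR (- t * X w)] <=
    P [set w | (X w <= y)%R] + (expR (- (t * y)))%:E)%E.
Proof.
move=> X0 t0; have mA := measurable_rv_le X y.
rewrite unlock; set A := [set w | X w <= y] in mA *.
have -> : (P A + (expR (- (t * y)))%:E =
    \int[P]_w ((\1_A w)%:E + (expR (- (t * y)))%:E))%E.
  rewrite ge0_integralD//; last first.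
    by apply/measurable_EFinP; exact: measurable_indic.
  by rewrite integral_indic// setIT integral_cst//= probability_setT mule1.
apply: ae_ge0_le_integral => //.
- apply/measurable_EFinP; apply: measurableT_comp => //.
  exact: measurable_funM.
- by move=> w _; rewrite adde_ge0// lee_fin ?expR_ge0.
- apply: emeasurable_funD => //.
  by apply/measurable_EFinP; exact: measurable_indic.
exists [set w | X w <= 0]; split.
- exact: measurable_rv_le.
- exact: positive_rv_le0.
move=> w /= H; rewrite leNgt; apply/negP => Xw0; apply: H => _.
rewrite -EFinD lee_fin indicE; case: (boolP (w \in A)).
  move=> _; rewrite (@le_trans _ _ 1)// ?lerDl ?expR_ge0//.
  by rewrite expR_le1 mulNr oppr_le0 mulr_ge0 ?ltW.
rewrite notin_setE /A /= => /negP; rewrite -ltNge => yX.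
by rewrite add0r ler_expR mulNr lerN2 ler_wpM2l// ltW.
Qed.

(** The upper bound at [y = 0] is finite. Finiteness lets inequalities between extended reals pass
    through [fine]. *)
Lemma laplace_fin_num d (T : measurableType d) (R : realType)
    (P : probability T R) (X : {RV P >-> R}) (t : R) :
  positive_rv X -> 0 < t -> 'E_P[fun w => expR (- t * X w)]%E \is a fin_num.
Proof.
move=> X0 t0; rewrite ge0_fin_numE; last first.
  by rewrite unlock integral_ge0// => w _; rewrite lee_fin expR_ge0.
rewrite (le_lt_trans (laplace_le 0 X0 t0))// -ge0_fin_numE ?adde_ge0//.
  by rewrite fin_numD fin_num_measure//; exact: measurable_rv_le.
Qed.

(** Markov's inequality: the integrand dominates e^(-ty) times the indicator of [A]. *)
Lemma laplace_ge d (T : measurableType d) (R : realType)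
    (P : probability T R) (X : {RV P >-> R}) (t y : R) :
  0 < t ->
  ((expR (- (t * y)))%:E * P [set w | (X w <= y)%R] <=
    'E_P[fun w => expR (- t * X w)])%E.
Proof.
move=> t0; have mA := measurable_rv_le X y.
rewrite unlock; set A := [set w | X w <= y] in mA *.
have -> : ((expR (- (t * y)))%:E * P A =
    \int[P]_w ((expR (- (t * y)))%:E * (\1_A w)%:E))%E.
  rewrite ge0_integralZl_EFin ?expR_ge0//; last first.
    by apply/measurable_EFinP; exact: measurable_indic.
  by rewrite integral_indic// setIT.
apply: ge0_le_integral => //.
- under eq_fun do rewrite -EFinM.
  by apply/measurable_EFinP/measurable_funM => //; exact: measurable_indic.
- apply/measurable_EFinP; apply: measurableT_comp => //.
  exact: measurable_funM.
move=> w _; rewrite -EFinM lee_fin indicE; case: (boolP (w \in A)).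
  by rewrite inE /A /= => Xy; rewrite mulr1 ler_expR mulNr lerN2 ler_wpM2l// ltW.
by rewrite mulr0 expR_ge0.
Qed.

(** * Functional inequalities from the fixed-point equation, and conclusion *)

Lemma smoothing_fixed_point_cdf (R : realType)
    d (T : measurableType d) (P : probability T R) (W : {RV P >-> R})
    d' (T' : measurableType d') (P' : probability T' R) (Y : {RV P' >-> R})
    (x y : R) :
  positive_rv W -> smoothing_fixed_point W Y -> 0 < x -> 0 < y ->
  fine (P' [set w | Y w <= x * y]) <=
    (fine (P [set w | W w <= x]) + fine (P' [set w | Y w <= y])) ^+ 2 /\
  (fine (P [set w | W w <= x]) * fine (P' [set w | Y w <= y])) ^+ 2 <=
    fine (P' [set w | Y w <= 2 * (x * y)]).
Proof.
move=> Wpos [Ypos [d0 [T0 [P0 [W0 [W1 [Y0 [Y1]]]]]]]].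
move=> [indep [eW0 eW1] [eY0 eY1] eY] x0 y0.
have law (dd : measure_display) (TT : measurableType dd) (PP : probability TT R)
    (X : {RV PP >-> R}) (X' : {RV P0 >-> R}) r :
    eq_in_distribution P0 X' PP X ->
    P0 [set w | X' w <= r] = PP [set w | X w <= r].
  by move=> eX; exact: eX (measurable_le_set r).
have W0E r := law _ _ _ _ _ r eW0; have W1E r := law _ _ _ _ _ r eW1.
have Y0E r := law _ _ _ _ _ r eY0; have Y1E r := law _ _ _ _ _ r eY1.
pose S r := [set w | W0 w * Y0 w + W1 w * Y1 w <= r].
have YE r : P' [set w | Y w <= r] = P0 (S r) := eY _ (measurable_le_set r).
have mf : measurable_fun setT (fun w => W0 w * Y0 w + W1 w * Y1 w).
  by apply: measurable_funD; apply: measurable_funM.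
have mS r : measurable (S r).
  rewrite -[S r]setTI; exact: mf measurableT _ (measurable_le_set r).
have mle := measurable_rv_le.
(* Off this null set all four variables are positive, as comparing products requires. *)
pose N := ([set w | W0 w <= 0] `|` [set w | W1 w <= 0]) `|`
  ([set w | Y0 w <= 0] `|` [set w | Y1 w <= 0]).
have mN : measurable N by do 2 apply: measurableU; exact: mle.
have N0 : P0 N = 0%E.
  have mU2 (X X' : {RV P0 >-> R}) :
      measurable ([set w | X w <= 0] `|` [set w | X' w <= 0]).
    by apply: measurableU; exact: mle.
  apply: (null_set_setU (mU2 _ _) (mU2 _ _));
    apply: (null_set_setU (mle _ _ _ _ _ _) (mle _ _ _ _ _ _)).
  - exact: etrans (W0E 0) (positive_rv_le0 Wpos).
  - exact: etrans (W1E 0) (positive_rv_le0 Wpos).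
  - exact: etrans (Y0E 0) (positive_rv_le0 Ypos).
  - exact: etrans (Y1E 0) (positive_rv_le0 Ypos).
have NC w : ~ N w -> [/\ 0 < W0 w, 0 < W1 w, 0 < Y0 w & 0 < Y1 w].
  by rewrite /N /= => Nw; split; rewrite ltNge; apply/negP => le0; apply: Nw; tauto.
set p := fine (P [set w | W w <= x]); set g := fine (P' [set w | Y w <= y]).
(* Events, probabilities and Borel sets follow the order [W0], [W1], [Y0], [Y1] of the independence
   hypothesis, so indices agree. *)
pose A := tnth [tuple [set w | W0 w <= x]; [set w | W1 w <= x];
  [set w | Y0 w <= y]; [set w | Y1 w <= y]].
pose a := tnth [tuple p; p; g; g].
pose B := tnth [tuple [set r : R | r <= x]; [set r | r <= x];
  [set r | r <= y]; [set r | r <= y]].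
have forall4 (Q : 'I_4 -> Prop) : Q 0 -> Q 1 -> Q 2 -> Q 3 -> forall i, Q i.
  move=> q0 q1 q2 q3 [[|[|[|[|//]]]] i4].
  - by rewrite (_ : Ordinal i4 = 0); last exact: val_inj.
  - by rewrite (_ : Ordinal i4 = 1); last exact: val_inj.
  - by rewrite (_ : Ordinal i4 = 2); last exact: val_inj.
  - by rewrite (_ : Ordinal i4 = 3); last exact: val_inj.
have mB : forall i, measurable (B i).
  by apply: forall4; exact: measurable_le_set.
have AE : forall i, A i = tnth [tuple W0; W1; Y0; Y1] i @^-1` B i.
  exact: forall4.
have PA : forall i, P0 (A i) = (a i)%:E.
  by apply: forall4; rewrite /A /a /= ?W0E ?W1E ?Y0E ?Y1E fineK// fin_num_measure//; exact: mle.
have mA i : measurable (A i) by rewrite AE; exact: measurable_funPTI.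
have PAI i j : i != j -> fine (P0 (A i `&` A j)) = a i * a j.
  move=> ij; rewrite !AE (mutually_independent_pair indep ij)//.
  by rewrite -!AE !PA.
have [a0 a1 a2 a3] : [/\ a 0 = p, a 1 = p, a 2 = g & a 3 = g] by [].
split.
  rewrite YE.
  (* Each summand is at most [x * y], so ([A 0] or [A 2]) and ([A 1] or [A 3]) hold. Distributing
     gives four intersections of independent events, whose probabilities sum to [(p + g) ^+ 2]. *)
  have sub : S (x * y) `<=` N `|` ((A 0 `&` A 1 `|` A 0 `&` A 3) `|`
      (A 2 `&` A 1 `|` A 2 `&` A 3)).
    move=> w Sw; have [|/NC[w0 w1 z0 z1]] := pselect (N w); first by left.
    right; rewrite /A /=.
    have prod_le (u v : R) : 0 < u -> 0 < v -> u * v <= x * y -> u <= x \/ v <= y.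
      move=> u0 v0 uv; have [|xu] := leP u x; first by left.
      right; rewrite leNgt; apply/negP => yv; move: uv; rewrite leNgt => /negP; apply.
      by rewrite ltr_pM// ltW.
    have h0 : W0 w * Y0 w <= x * y.
      by apply: le_trans Sw; rewrite lerDl mulr_ge0// ltW.
    have h1 : W1 w * Y1 w <= x * y.
      by apply: le_trans Sw; rewrite lerDr mulr_ge0// ltW.
    have := prod_le _ _ w0 z0 h0; have := prod_le _ _ w1 z1 h1; tauto.
  have mI i j : measurable (A i `&` A j) by exact: measurableI.
  have mU i j k l : measurable (A i `&` A j `|` A k `&` A l) by exact: measurableU.
  apply: (le_trans (fine_probability_subU P0 (mS _) mN _ sub)); first exact: measurableU.
  rewrite N0 add0r.
  apply: (le_trans (fine_probability_subU P0 _ _ _ (@subset_refl _ _))) => //.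
    exact: measurableU.
  apply: (le_trans (lerD (fine_probability_subU P0 _ _ _ (@subset_refl _ _))
    (fine_probability_subU P0 _ _ _ (@subset_refl _ _)))) => //.
  by rewrite !PAI// a0 a1 a2 a3 le_eqVlt; apply/orP; left; apply/eqP; ring.
rewrite YE.
have sub : \bigcap_i A i `<=` N `|` S (2 * (x * y)).
  move=> w Aw; have [|/NC[w0 w1 z0 z1]] := pselect (N w); first by left.
  right; rewrite /S /= (_ : 2 * _ = x * y + x * y); last by ring.
  have [/= b0 b1 b2 b3] := And4 (Aw 0 I) (Aw 1 I) (Aw 2 I) (Aw 3 I).
  by apply: lerD; apply: ler_pM; rewrite ?(ltW w0) ?(ltW w1) ?(ltW z0) ?(ltW z1).
have mcap : measurable (\bigcap_i A i) by apply: fin_bigcap_measurable.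
have := fine_probability_subU P0 mcap mN (mS _) sub.
rewrite N0 add0r; apply: le_trans.
have -> : P0 (\bigcap_i A i) = (\prod_i P0 (A i))%E.
  under eq_bigcapr do rewrite AE.
  by rewrite (mutually_independent_all indep mB); apply: eq_bigr => i _; rewrite AE.
rewrite !big_ord_recl big_ord0 !PA.
(* The lifted ordinals left by [big_ord_recl] are convertible to the numerals used here. *)
change (fine ((a 0)%:E * ((a 1)%:E * ((a 2)%:E * ((a 3)%:E * 1))))%E >= (p * g) ^+ 2).
rewrite a0 a1 a2 a3 /=.
by rewrite le_eqVlt; apply/orP; left; apply/eqP; ring.
Qed.

(* The real-valued [ln] vanishes on nonpositive arguments. This is harmless:
   if P(W <= x) = 0 for some x > 0, the first quotient below is eventually 0,
   which is excluded by [1 < gamma] (mathematically it would be +oo); and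
   0 < E[exp(- t Y)] < 1 for t > 0 since Y is positive. *)
Theorem theorem2 (R : realType) (gamma : R)
    (d : measure_display) (T : measurableType d) (P : probability T R)
    (W : {RV P >-> R})
    (d' : measure_display) (T' : measurableType d') (P' : probability T' R)
    (Y : {RV P' >-> R}) :
  1 < gamma ->
  positive_rv W ->
  ln (ln (1 / fine (P [set w | W w <= x]))) / ln (ln (1 / x))
    @[x --> 0^'+] --> gamma ->
  smoothing_fixed_point W Y ->
  ln (ln (1 / fine ('E_P'[fun w => expR (- t * Y w)])%E)) / ln (ln t)
    @[t --> +oo] --> gamma.
Proof.
move=> gamma1 Wpos Wgamma YW; have [Ypos _] := YW.
pose p x := fine (P [set w | W w <= x]).
pose G y := fine (P' [set w | Y w <= y]).
have cdf := smoothing_fixed_point_cdf Wpos YW.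
apply: (@smoothing_laplace_cvg R gamma p G) => //.
- move=> x y xy; rewrite fine_le ?fin_num_measure//; try exact: measurable_rv_le.
  apply: le_measure; rewrite ?inE; try exact: measurable_rv_le.
  by move=> w /= /le_trans; exact.
- by move=> x; exact: fine_ge0.
- by move=> x; exact: fine_ge0.
- by move=> x y x0 y0; have [] := cdf x y x0 y0.
- by move=> x y x0 y0; have [] := cdf x y x0 y0.
- move=> t y t0 _; have le := laplace_le y Ypos t0.
  have Pfin : P' [set w | Y w <= y] \is a fin_num.
    by rewrite fin_num_measure//; exact: measurable_rv_le.
  rewrite (_ : G y + _ = fine (P' [set w | (Y w <= y)%R] + (expR (- (t * y)))%:E)).
    by rewrite fine_le// ?fin_numD ?Pfin// laplace_fin_num.
  by rewrite fineD.
- move=> t y t0 _; have := laplace_ge Y y t0.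
  have Pfin : P' [set w | Y w <= y] \is a fin_num.
    by rewrite fin_num_measure//; exact: measurable_rv_le.
  move=> ge; rewrite (_ : _ * G y = fine ((expR (- (t * y)))%:E * P' [set w | (Y w <= y)%R])).
    by rewrite fine_le// ?fin_numM// laplace_fin_num.
  by rewrite fineM.
(* This threshold is the smallness [4 * G y <= expR (- 1)] that the bootstrap starts from. *)
- have e0 : 0 < expR (-1) / 4 :> R by rewrite divr_gt0 ?expR_gt0.
  apply: filterS (near_right0_cdf Ypos e0) => y.
  by rewrite ltr_pdivlMr// mulrC => /ltW.
- exact: exists_cdf_gt0.
Qed.
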